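(* Let $0<q<1$ and let $a,b,c$ be real numbers with $a<0$, $a<b<0$ and $q/a<c<0$ (equivalently, $a=-1/\alpha$, $b=-q^s/\alpha$, $c=-q^{t+1}\alpha$ for some real $\alpha,s,t>0$). Then $$\sum_{n=-\infty}^\infty\frac{(1-a)_q^n\,(1-q/a)_q^{-n}}{(1-b)_q^n\,(1-c)_q^{-n}}=\frac{(1-a)_q^\infty(1-q/a)_q^\infty}{(1-b)_q^\infty(1-c)_q^\infty}\cdot\frac{(1-q)_q^\infty(1-bc/q)_q^\infty}{(1-b/a)_q^\infty(1-ac/q)_q^\infty}.$$
   Context: Notation, for $0<q<1$: $(1+u)_q^\infty=\prod_{j=0}^\infty(1+q^ju)$ and, for any integer $n$ (positive, zero or negative), $(1+u)_q^n=\dfrac{(1+u)_q^\infty}{(1+q^nu)_q^\infty}$; $(1-u)_q^n$ and $(1-u)_q^\infty$ are obtained by replacing $u$ with $-u$. *)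

(* Defs.v *)
From HB Require Import structures.
From mathcomp Require Import all_boot all_order all_algebra.
From mathcomp Require Import all_classical all_reals all_analysis.
Set Implicit Arguments.
Unset Strict Implicit.
Unset Printing Implicit Defensive.
Import Order.TTheory GRing.Theory Num.Theory.
Import numFieldNormedType.Exports.
Local Open Scope classical_set_scope.
Local Open Scope ring_scope.

(* (1 + u)_q^oo; (1 - u)_q^oo is [qpow_inf q (- u)]. The product converges
   for every u when 0 < q < 1; otherwise [limn] may be a default value. *)
Definition qpow_inf (R : realType) (q u : R) : R :=
  limn (fun n : nat => \prod_(0 <= j < n) (1 + q ^+ j * u)).

(* (1 + u)_q^n for an arbitrary integer n; here [q ^ n] is [exprz]. *)
Definition qpow (R : realType) (q u : R) (n : int) : R :=
  qpow_inf q u / qpow_inf q (q ^ n * u).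

(* The bilateral series of f over the integers converges, with sum l: both the
   part over n >= 0 and the part over n <= -1 converge. *)
Definition is_bilateral_sum (R : realType) (f : int -> R) (l : R) : Prop :=
  exists lp ln : R,
    [/\ series (fun k : nat => f k%:Z) @ \oo --> lp,
        series (fun k : nat => f (- k.+1%:Z)) @ \oo --> ln
      & l = lp + ln].

(* Main.v *)
Require Import Defs.
From HB Require Import structures.
From mathcomp Require Import all_boot all_order all_algebra.
From mathcomp Require Import all_classical all_reals all_analysis.
From mathcomp Require Import ring lra zify.
Set Implicit Arguments.
Unset Strict Implicit.
Unset Printing Implicit Defensive.
Import Order.TTheory GRing.Theory Num.Theory.
Import numFieldNormedType.Exports.
Local Open Scope classical_set_scope.
Local Open Scope ring_scope.

(* Put al = -a, be = -b, ga = -c, all positive, and P = qpow_inf q. Up to the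
   constant P(al) P(q/al) / (P(be) P(ga)), the n-th term of the series is
     w_n(be, ga) = P(q^n be) P(q^-n ga) / (P(q^n al) P(q^-n q/al)).
   A contiguity relation between w_n and w_{n+1} gives
     (1 - be/al) S(be, ga) = (1 - be ga/q) S(q be, ga)
   for the bilateral sum S, and n |-> -n, which exchanges (al, be, ga) with
   (q/al, ga, be), gives the analogous equation in ga. Iterating both and
   letting be, ga tend to 0 by dominated convergence yields
     S(be, ga) = P(-be ga/q) / (P(-be/al) P(-al ga/q)) S(0, 0).
   The argument does not need be and ga positive: for be = ga = -q the series
   has a single nonzero term, whence S(0, 0) = P(-q). *)

(** * Limits of real sequences *)

Lemma eq_cvgn (R : realType) (f g : R^nat) (l : R) :
  f =1 g -> f @ \oo --> l -> g @ \oo --> l.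
Proof. by move=> /funext ->. Qed.

Lemma cvgn_shift (R : realType) (N : nat) (f : R^nat) (l : R) :
  (fun n => f (n + N)%N) @ \oo --> l -> f @ \oo --> l.
Proof. by move=> h; rewrite -(cvg_shiftn N). Qed.

Lemma cvgnMl (R : realType) (c : R) (f : R^nat) (l : R) :
  f @ \oo --> l -> (fun n => c * f n) @ \oo --> c * l.
Proof. by move=> fl; apply: (cvgM (cvg_cst c) fl). Qed.

(** * Finite and infinite q-products *)

Definition qpow_fin (R : realType) (q u : R) (n : nat) : R :=
  \prod_(0 <= j < n) (1 + q ^+ j * u).

Lemma qpow_finD (R : realType) (q u : R) (m n : nat) :
  qpow_fin q u (m + n) = qpow_fin q u m * qpow_fin q (q ^+ m * u) n.
Proof.
elim: n => [|n IH]; first by rewrite addn0 /qpow_fin (big_geq (leqnn 0)) mulr1.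
rewrite addnS /qpow_fin big_nat_recr //= [in RHS]big_nat_recr //=.
by rewrite mulrA -IH mulrA -exprD addnC.
Qed.

Lemma qpow_fin1 (R : realType) (q u : R) : qpow_fin q u 1 = 1 + u.
Proof. by rewrite /qpow_fin big_nat1 expr0 mul1r. Qed.

Lemma qpow_finSr (R : realType) (q u : R) (n : nat) :
  qpow_fin q u n.+1 = qpow_fin q u n * (1 + q ^+ n * u).
Proof. by rewrite -addn1 qpow_finD qpow_fin1. Qed.

Lemma qpow_fin_ge1 (R : realType) (q u : R) (n : nat) :
  0 < q -> 0 <= u -> 1 <= qpow_fin q u n.
Proof.
move=> q0 u0; elim: n => [|n IH]; first by rewrite /qpow_fin big_geq.
rewrite qpow_finSr -[leLHS]mulr1 ler_pM //.
by rewrite lerDl mulr_ge0 // exprn_ge0 // ltW.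
Qed.

Lemma le_qpow_fin (R : realType) (q u v : R) (n : nat) :
  0 < q -> 0 <= u -> u <= v -> qpow_fin q u n <= qpow_fin q v n.
Proof.
move=> q0 u0 uv; rewrite /qpow_fin; apply: ler_prod => i _.
have qi : 0 <= q ^+ i by rewrite exprn_ge0 // ltW.
by rewrite lerD2l ler_wpM2l // andbT addr_ge0 // mulr_ge0.
Qed.

Lemma qpow_fin_le_expR (R : realType) (q u : R) (n : nat) :
  0 < q -> q < 1 -> 0 <= u -> qpow_fin q u n <= expR (u / (1 - q)).
Proof.
move=> q0 q1 u0.
(* The exponent is sharpened to the sum of the first [n] terms [q ^+ j * u], so that the induction
   closes with [1 + x <= expR x] for the new factor. *)
suff H : qpow_fin q u n <= expR (u * (1 - q ^+ n) / (1 - q)).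
  apply: (le_trans H); rewrite ler_expR ler_pM2r ?invr_gt0 ?subr_gt0 //.
  by rewrite ler_piMr // gerBl exprn_ge0 // ltW.
elim: n => [|n IH].
  by rewrite /qpow_fin big_geq // expr0 subrr mulr0 mul0r expR0.
rewrite qpow_finSr.
have -> : u * (1 - q ^+ n.+1) / (1 - q) =
    u * (1 - q ^+ n) / (1 - q) + q ^+ n * u.
  by rewrite exprS; field; rewrite subr_eq0 gt_eqF.
rewrite expRD ler_pM ?expR_ge1Dx //.
- by rewrite (le_trans ler01) // qpow_fin_ge1.
- by rewrite addr_ge0 // mulr_ge0 // exprn_ge0 // ltW.
Qed.

Lemma qpow_factor_itv (R : realType) (q u : R) (n : nat) :
  0 < q -> q < 1 -> -1 <= u -> u <= 0 -> 0 <= 1 + q ^+ n * u <= 1.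
Proof.
move=> q0 q1 u1 u0.
have qn0 : 0 <= q ^+ n by rewrite exprn_ge0 // ltW.
have qn1 : q ^+ n <= 1 by rewrite exprn_ile1 // ltW.
by apply/andP; split; nra.
Qed.

Lemma qpow_fin_itv (R : realType) (q u : R) (n : nat) :
  0 < q -> q < 1 -> -1 <= u -> u <= 0 -> 0 <= qpow_fin q u n <= 1.
Proof.
move=> q0 q1 u1 u0; elim: n => [|n /andP[IH1 IH2]].
  by rewrite /qpow_fin big_geq // ler01 lexx.
have /andP[h1 h2] := qpow_factor_itv n q0 q1 u1 u0.
by rewrite qpow_finSr mulr_ge0 //= mulr_ile1.
Qed.

Lemma near_qpow_small (R : realType) (q u e : R) :
  0 < q -> q < 1 -> 0 < e -> \forall n \near \oo, `|q ^+ n * u| < e.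
Proof.
move=> q0 q1 e0.
have /cvgrPdist_lt h : (fun n => q ^+ n * u) @ \oo --> 0 * u.
  by apply: (cvgM _ (cvg_cst u)); apply: cvg_expr; rewrite ger0_norm // ltW.
near=> n; have : `|0 * u - q ^+ n * u| < e by near: n; exact: h.
by rewrite mul0r sub0r normrN.
Unshelve. all: by end_near. Qed.

(** For arguments of modulus below 1 the partial products are monotone and bounded: increasing below
    an exponential if the argument is nonnegative, decreasing in the unit interval otherwise. A
    general [u] reduces to this case by splitting off finitely many factors. *)
Lemma is_cvg_qpow_fin (R : realType) (q u : R) :
  0 < q -> q < 1 -> cvgn (qpow_fin q u).
Proof.
move=> q0 q1.
have small v : `|v| < 1 -> cvgn (qpow_fin q v).
  rewrite ltr_norml => /andP[v1 v2]; have [v0|v0] := leP 0 v.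
    apply: nondecreasing_is_cvgn.
      apply/nondecreasing_seqP => n; rewrite qpow_finSr ler_peMr //.
        by rewrite (le_trans ler01) // qpow_fin_ge1.
      by rewrite lerDl mulr_ge0 // exprn_ge0 // ltW.
    exists (expR (v / (1 - q))) => _ [n _ <-].
    exact: qpow_fin_le_expR.
  have h n := qpow_fin_itv n q0 q1 (ltW v1) (ltW v0).
  apply: nonincreasing_is_cvgn.
    apply/nonincreasing_seqP => n; rewrite qpow_finSr ler_piMr //.
      by have /andP[] := h n.
    by have /andP[] := qpow_factor_itv n q0 q1 (ltW v1) (ltW v0).
  by exists 0 => _ [n _ <-]; have /andP[] := h n.
have [N _ /(_ N (leqnn N)) hN] := near_qpow_small u q0 q1 ltr01.
have /cvg_ex[l hl] := small _ hN.
apply/cvg_ex; exists (qpow_fin q u N * l).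
apply: (@cvgn_shift _ N).
apply: eq_cvgn (cvgnMl (c := qpow_fin q u N) hl) => n.
by rewrite /= addnC qpow_finD.
Qed.

Lemma cvg_qpow_fin (R : realType) (q u : R) :
  0 < q -> q < 1 -> qpow_fin q u @ \oo --> qpow_inf q u.
Proof. exact: is_cvg_qpow_fin. Qed.

Lemma qpow_infD (R : realType) (q u : R) (N : nat) : 0 < q -> q < 1 ->
  qpow_inf q u = qpow_fin q u N * qpow_inf q (q ^+ N * u).
Proof.
move=> q0 q1; apply: cvg_lim => //; apply: (@cvgn_shift _ N).
apply: eq_cvgn (cvgnMl (c := qpow_fin q u N)
  (cvg_qpow_fin (u := q ^+ N * u) q0 q1)) => n.
by rewrite /= addnC -qpow_finD.
Qed.

Lemma qpow_infS (R : realType) (q u : R) : 0 < q -> q < 1 ->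
  qpow_inf q u = (1 + u) * qpow_inf q (q * u).
Proof.
by move=> q0 q1; rewrite (qpow_infD u 1 q0 q1) qpow_fin1 expr1.
Qed.

Lemma qpow_inf0 (R : realType) (q : R) : qpow_inf q 0 = 1.
Proof.
rewrite /qpow_inf (_ : (fun n => _) = cst 1); first exact: lim_cst.
by apply/funext => n; rewrite big1 // => i _; rewrite mulr0 addr0.
Qed.

Lemma le_qpow_inf (R : realType) (q u v : R) : 0 < q -> q < 1 ->
  0 <= u -> u <= v -> qpow_inf q u <= qpow_inf q v.
Proof.
move=> q0 q1 u0 uv; apply: ler_lim; try exact: is_cvg_qpow_fin.
by near=> n; exact: le_qpow_fin.
Unshelve. all: by end_near. Qed.

Lemma qpow_inf_ge1 (R : realType) (q u : R) : 0 < q -> q < 1 ->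
  0 <= u -> 1 <= qpow_inf q u.
Proof. by move=> q0 q1 u0; rewrite -(qpow_inf0 q) le_qpow_inf. Qed.

Lemma qpow_inf_gt0 (R : realType) (q u : R) : 0 < q -> q < 1 ->
  0 <= u -> 0 < qpow_inf q u.
Proof. by move=> *; rewrite (lt_le_trans ltr01) // qpow_inf_ge1. Qed.

Lemma qpow_inf_itv (R : realType) (q u : R) : 0 < q -> q < 1 ->
  -1 <= u -> u <= 0 -> 0 <= qpow_inf q u <= 1.
Proof.
move=> q0 q1 u1 u0; apply/andP; split.
  apply: limr_ge; first exact: is_cvg_qpow_fin.
  by near=> n; have /andP[] := qpow_fin_itv n q0 q1 u1 u0.
apply: limr_le; first exact: is_cvg_qpow_fin.
by near=> n; have /andP[] := qpow_fin_itv n q0 q1 u1 u0.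
Unshelve. all: by end_near. Qed.

Lemma qpow_inf_neq0 (R : realType) (q u : R) : 0 < q -> q < 1 ->
  -1 < u -> qpow_inf q u != 0.
Proof.
move=> q0 q1 u1; have [u0|u0] := leP 0 u; first by rewrite gt_eqF // qpow_inf_gt0.
(* With [v = - u / (1 + u)], each factor satisfies
   [1 <= (1 + q^j u) (1 + q^j v)]. *)
pose v := - u / (1 + u).
have p1 : 0 < 1 + u by lra.
have v0 : 0 <= v by rewrite divr_ge0 //; lra.
have ev : u + v + u * v = 0 by rewrite /v; field; rewrite gt_eqF.
suff : 1 <= qpow_inf q u * qpow_inf q v.
  by apply: contraTneq => ->; rewrite mul0r -ltNge ltr01.
have h : (fun n => qpow_fin q u n * qpow_fin q v n) @ \oo
    --> qpow_inf q u * qpow_inf q v.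
  by apply: cvgM; exact: cvg_qpow_fin.
rewrite -(cvg_lim _ h) //; apply: limr_ge; first by apply/cvg_ex; eexists; exact: h.
apply: nearW; elim => [|k IH]; first by rewrite /qpow_fin !big_geq ?mulr1.
rewrite !qpow_finSr mulrACA -[leLHS]mulr1 ler_pM //.
have qk0 : 0 <= q ^+ k by rewrite exprn_ge0 // ltW.
have qk1 : q ^+ k <= 1 by rewrite exprn_ile1 // ltW.
have : 0 <= (q ^+ k * (1 - q ^+ k)) * (- u * v).
  rewrite mulr_ge0 // mulr_ge0 //; first by rewrite subr_ge0.
  by rewrite oppr_ge0 ltW.
have -> : (1 + q ^+ k * u) * (1 + q ^+ k * v) =
    1 + q ^+ k * (u + v + u * v) + q ^+ k * (1 - q ^+ k) * (- u * v) by ring.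
by rewrite ev; lra.
Qed.

(** For [|v| < 1] the infinite product P(v) is nonzero and P(q^n v) is P(v) divided by its [n]-th
    partial product, which tends to P(v). A general [u] follows by shifting the sequence. *)
Lemma cvg_qpow_inf1 (R : realType) (q u : R) : 0 < q -> q < 1 ->
  (fun n => qpow_inf q (q ^+ n * u)) @ \oo --> (1 : R).
Proof.
move=> q0 q1.
have small v : `|v| < 1 -> (fun n => qpow_inf q (q ^+ n * v)) @ \oo --> (1 : R).
  rewrite ltr_norml => /andP[v1 _]; have Pv := qpow_inf_neq0 q0 q1 v1.
  rewrite -(divff Pv).
  apply: eq_cvgn (cvgnMl (c := qpow_inf q v)
    (cvgV Pv (cvg_qpow_fin (u := v) q0 q1))) => n.
  rewrite /= {1}(qpow_infD v n q0 q1) mulrAC divff ?mul1r //.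
  by apply: contraNneq Pv => e; rewrite (qpow_infD v n q0 q1) e mul0r.
have [N _ /(_ N (leqnn N)) hN] := near_qpow_small u q0 q1 ltr01.
apply: (@cvgn_shift _ N); apply: eq_cvgn (small _ hN) => n.
by rewrite /= mulrA -exprD.
Qed.

(** * Operations on bilateral sums *)

Lemma cvg_series_shift (R : realType) (f : R^nat) (l : R) :
  series f @ \oo --> l -> series (fun k => f k.+1) @ \oo --> l - f 0%N.
Proof.
rewrite -(cvg_shiftS (series f)) => h.
apply: eq_cvgn (cvgB h (cvg_cst (f 0%N))) => n.
by rewrite !fctE /series /= big_nat_recl // addrC addKr.
Qed.

Lemma cvg_series_unshift (R : realType) (f : R^nat) (l : R) :
  series (fun k => f k.+1) @ \oo --> l -> series f @ \oo --> l + f 0%N.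
Proof.
move=> h; apply: (@cvgn_shift _ 1).
apply: eq_cvgn (cvgD h (cvg_cst (f 0%N))) => n.
by rewrite addn1 !fctE /series /= big_nat_recl // addrC.
Qed.

Lemma bilateral_sum_unique (R : realType) (f : int -> R) (l l' : R) :
  is_bilateral_sum f l -> is_bilateral_sum f l' -> l = l'.
Proof.
move=> [p [m [hp hm ->]]] [p' [m' [hp' hm' ->]]].
by rewrite -(cvg_lim _ hp) // -(cvg_lim _ hm) // (cvg_lim _ hp') // (cvg_lim _ hm').
Qed.

Lemma eq_bilateral_sum (R : realType) (f g : int -> R) (l : R) :
  f =1 g -> is_bilateral_sum f l -> is_bilateral_sum g l.
Proof. by move=> /funext ->. Qed.

Lemma bilateral_sumB (R : realType) (f g : int -> R) (l l' : R) :
  is_bilateral_sum f l -> is_bilateral_sum g l' ->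
  is_bilateral_sum (fun n => f n - g n) (l - l').
Proof.
move=> [p [m [hp hm ->]]] [p' [m' [hp' hm' ->]]].
exists (p - p'), (m - m'); split; last by rewrite opprD addrACA.
- by apply: eq_cvgn (cvgB hp hp') => n; rewrite !fctE /series /= sumrB.
- by apply: eq_cvgn (cvgB hm hm') => n; rewrite !fctE /series /= sumrB.
Qed.

Lemma bilateral_sumZ (R : realType) (f : int -> R) (c l : R) :
  is_bilateral_sum f l -> is_bilateral_sum (fun n => c * f n) (c * l).
Proof.
move=> [p [m [hp hm ->]]]; exists (c * p), (c * m); split; last by rewrite mulrDr.
- by apply: eq_cvgn (cvgnMl (c := c) hp) => n; rewrite /series /= mulr_sumr.
- by apply: eq_cvgn (cvgnMl (c := c) hm) => n; rewrite /series /= mulr_sumr.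
Qed.

(** The term [f 0] passes from the nonnegative half to the negative half, where it sits at index
    -1. *)
Lemma bilateral_sum_shift (R : realType) (f : int -> R) (l : R) :
  is_bilateral_sum f l -> is_bilateral_sum (fun n => f (n + 1)) l.
Proof.
move=> [p [m [hp hm ->]]]; exists (p - f 0), (m + f 0); split; last first.
- by rewrite addrACA [- _ + _]addrC subrr addr0.
- apply: (cvg_series_unshift (f := fun k => f (- k.+1%:Z + 1))).
  by apply: eq_cvgn hm => n; congr (series _ n); apply/funext => k; congr f; lia.
- apply: eq_cvgn (cvg_series_shift hp) => n.
  by congr (series _ n); apply/funext => k; congr f; lia.
Qed.

(** The two halves exchange roles, except that [f 0] must stay in the nonnegative one. *)
Lemma bilateral_sumN (R : realType) (f : int -> R) (l : R) :
  is_bilateral_sum f l -> is_bilateral_sum (fun n => f (- n)) l.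
Proof.
move=> [p [m [hp hm ->]]]; exists (m + f 0), (p - f 0); split; last first.
- by rewrite addrACA subrr addr0 addrC.
- apply: eq_cvgn (cvg_series_shift hp) => n.
  by congr (series _ n); apply/funext => k; congr f; lia.
- apply: (cvg_series_unshift (f := fun k => f (- k%:Z))).
  exact: hm.
Qed.

Lemma bilateral_sum_single (R : realType) (f : int -> R) :
  (forall n, n != 0 -> f n = 0) -> is_bilateral_sum f (f 0).
Proof.
move=> f0; have z (g : R^nat) : (forall n, g n = 0) -> series g @ \oo --> (0 : R).
  move=> g0; apply: eq_cvgn (cvg_cst 0) => n.
  by rewrite /series /= big1.
exists (f 0), 0; split; last by rewrite addr0.
- rewrite -[f 0]add0r; apply: (cvg_series_unshift (f := fun k => f k%:Z)).
  by apply: z => n; apply: f0.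
- by apply: z => n; apply: f0.
Qed.

(** * Dominated convergence and the ratio test *)

Lemma le_series_tail (R : realType) (f D : R^nat) (l d : R) (K : nat) :
  (forall k, `|f k| <= D k) -> series f @ \oo --> l -> series D @ \oo --> d ->
  `|l - series f K| <= d - series D K.
Proof.
move=> fD hf hD.
have h1 : (fun n => `|series f n - series f K|) @ \oo --> `|l - series f K|.
  by apply: cvg_norm; apply: cvgB hf (cvg_cst _).
have h2 : (fun n => series D n - series D K) @ \oo --> d - series D K.
  by apply: cvgB hD (cvg_cst _).
apply: (ler_cvg_to h1 h2); near=> n.
have Kn : (K <= n)%N by near: n; exact: nbhs_infty_ge.
rewrite !sub_series_geq //; apply: le_trans (ler_norm_sum _ _ _) _.
exact: ler_sum.
Unshelve. all: by end_near. Qed.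

(** Tannery's theorem. Cut at a [K] where the tail of [D] is below [e / 3]: the tails of [v] and of
    [u N] are then small uniformly in [N], and the finite sums up to [K] converge termwise. *)
Lemma cvg_series_dominated (R : realType) (u : nat -> R^nat) (v D l : R^nat) :
  (forall N k, `|u N k| <= D k) -> cvgn (series D) ->
  (forall k, (fun N => u N k) @ \oo --> v k) ->
  (forall N, series (u N) @ \oo --> l N) ->
  exists2 s : R, series v @ \oo --> s & l @ \oo --> s.
Proof.
move=> uD cD uv ul.
have vD k : `|v k| <= D k.
  have h : (fun N => `|u N k|) @ \oo --> `|v k| by apply: cvg_norm; exact: uv.
  by apply: (ler_cvg_to h (cvg_cst (D k))); apply: nearW.
have D0 k : 0 <= D k by apply: le_trans (vD k).
have /cvg_ex[s hs] : cvgn (series v).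
  by apply: normed_cvg; apply: series_le_cvg vD cD => // k.
exists s; first exact: hs.
have /cvg_ex[d hd] := cD.
have part K : (fun N => series (u N) K) @ \oo --> series v K.
  elim: K => [|K IH].
    by apply: eq_cvgn (cvg_cst _) => N; rewrite /series /= !big_geq.
  rewrite seriesSr; apply: eq_cvgn (cvgD IH (uv K)) => N.
  by rewrite !fctE !seriesSr.
apply/cvgrPdist_lt => e e0.
have e3 : 0 < e / 3 by rewrite divr_gt0.
have /cvgrPdist_lt/(_ _ e3)[K _ /(_ K (leqnn K)) hK] := hd.
have /cvgrPdist_lt/(_ _ e3) hp := part K.
near=> N.
have h1 := le_series_tail K (uD N) (ul N) hd.
have h2 := le_series_tail K vD hs hd.
have h3 : `|series v K - series (u N) K| < e / 3 by near: N; exact: hp.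
have h4 : d - series D K < e / 3 by apply: le_lt_trans hK; exact: ler_norm.
have -> : s - l N = (s - series v K) + (series v K - series (u N) K)
   - (l N - series (u N) K) by ring.
apply: le_lt_trans (ler_normB _ _) _.
apply: le_lt_trans (lerD (ler_normD _ _) (lexx _)) _.
by move: h1 h2 h3 h4; lra.
Unshelve. all: by end_near. Qed.

(** Tannery's theorem on each half gives a sum for [v] that is also the limit of [l], hence is
    [s]. *)
Lemma bilateral_sum_dominated (R : realType) (u : nat -> int -> R)
    (v D : int -> R) (d s : R) (l : R^nat) :
  (forall N k, `|u N k| <= D k) -> is_bilateral_sum D d ->
  (forall k, (fun N => u N k) @ \oo --> v k) ->
  (forall N, is_bilateral_sum (u N) (l N)) -> l @ \oo --> s ->
  is_bilateral_sum v s.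
Proof.
move=> uD [dp [dm [hdp hdm _]]] uv /choice[lp /choice[lm hl]] ls.
have [p hp lpp] : exists2 p : R,
    series (fun k : nat => v k%:Z) @ \oo --> p & lp @ \oo --> p.
  apply: (cvg_series_dominated (u := fun N k => u N k%:Z)
    (D := fun k => D k%:Z)) => // [|N].
    by apply/cvg_ex; exists dp.
  by have [] := hl N.
have [m hm lmm] : exists2 m : R,
    series (fun k : nat => v (- k.+1%:Z)) @ \oo --> m & lm @ \oo --> m.
  apply: (cvg_series_dominated (u := fun N k => u N (- k.+1%:Z))
    (D := fun k => D (- k.+1%:Z))) => // [|N].
    by apply/cvg_ex; exists dm.
  by have [] := hl N.
exists p, m; split => //.
have h : l @ \oo --> p + m.
  by apply: eq_cvgn (cvgD lpp lmm) => N; have [_ _ ->] := hl N.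
by rewrite -(cvg_lim _ ls) // (cvg_lim _ h).
Qed.

(** Beyond some rank the ratio stays below the midpoint [t] of [r] and 1, so a geometric series
    dominates. Writing the ratio as a multiplier [rho] avoids dividing by terms that may vanish. *)
Lemma cvg_series_ratio (R : realType) (u rho : R^nat) (r : R) :
  (forall n, 0 <= u n) -> (forall n, u n.+1 = rho n * u n) ->
  rho @ \oo --> r -> 0 <= r -> r < 1 -> cvgn (series u).
Proof.
move=> u0 urho hr r0 r1.
pose t := (r + 1) / 2.
have t0 : 0 <= t by rewrite /t; lra.
have t1 : t < 1 by rewrite /t; lra.
have [N _ hN] : \forall n \near \oo, rho n < t.
  by apply: (cvgr_lt _ hr); rewrite /t; lra.
have le_geo n : u (n + N)%N <= geometric (u N) t n.
  elim: n => [|n IH]; first by rewrite /= expr0 mulr1.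
  rewrite addSn urho; have hn := hN (n + N)%N (leq_addl _ _).
  apply: (le_trans (ler_wpM2r (u0 _) (ltW hn))).
  by rewrite /= exprS mulrCA ler_wpM2l.
have /cvg_ex[l hl] : cvgn (series (fun n => u (n + N)%N)).
  apply: series_le_cvg (le_geo) _ => //.
    by move=> n; rewrite geometric_ge0.
  by apply: is_cvg_geometric_series; rewrite ger0_norm.
apply/cvg_ex; exists (series u N + l); apply: (@cvgn_shift _ N).
apply: eq_cvgn (cvgD (cvg_cst (series u N)) hl) => n.
by rewrite series_addn -[X in index_iota X]add0n big_addn addnK.
Qed.

(** * Terms of the series and their contiguity relations *)

(** The [w_n] of the overview: up to a factor free of [n], the general term of Ramanujan's 1psi1
    series. *)
Definition psi_term (R : realType) (q al be ga : R) (n : int) : R :=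
  (qpow_inf q (q ^ n * be) * qpow_inf q (q ^ (- n) * ga)) /
  (qpow_inf q (q ^ n * al) * qpow_inf q (q ^ (- n) * (q / al))).

(** The expected ratio S(be, ga) / S(0, 0). *)
Definition psi_const (R : realType) (q al be ga : R) : R :=
  qpow_inf q (- (be * ga / q)) /
  (qpow_inf q (- (be / al)) * qpow_inf q (- (al * ga / q))).

(** Together with [psi_constC], this transfers results about [be] to [ga]. *)
Lemma psi_termN (R : realType) (q al be ga : R) (n : int) :
  0 < q -> 0 < al ->
  psi_term q al be ga (- n) = psi_term q (q / al) ga be n.
Proof.
move=> q0 al0; rewrite /psi_term opprK.
have -> : q / (q / al) = al by field; rewrite !gt_eqF.
by congr (_ / _); rewrite mulrC.
Qed.

Lemma psi_constC (R : realType) (q al be ga : R) : 0 < q -> 0 < al ->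
  psi_const q al be ga = psi_const q (q / al) ga be.
Proof.
move=> q0 al0; rewrite /psi_const.
have -> : ga / (q / al) = al * ga / q by field; rewrite !gt_eqF.
have -> : q / al * be / q = be / al by field; rewrite !gt_eqF.
by rewrite [ga * be]mulrC; congr (_ / _); rewrite mulrC.
Qed.

Lemma psi_den_neq0 (R : realType) (q al : R) (n : int) :
  0 < q -> q < 1 -> 0 < al -> qpow_inf q (q ^ n * al) != 0.
Proof.
by move=> q0 q1 al0; rewrite gt_eqF // qpow_inf_gt0 // mulr_ge0 ?exprz_ge0 // ltW.
Qed.

(** Quasi-periodicity of the theta function T(x) = P(x) P(q/x), namely T(x) = x T(qx), at x = q^n
    al. It comes from P(x) = (1 + x) P(qx), P(1/x) = (1 + 1/x) P(q/x) and 1 + x = x (1 + 1/x). *)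
Lemma psi_term_den_shift (R : realType) (q al : R) (n : int) :
  0 < q -> q < 1 -> 0 < al ->
  qpow_inf q (q ^ n * al) * qpow_inf q (q ^ (- n) * (q / al)) =
  q ^ n * al *
  (qpow_inf q (q ^ (n + 1) * al) * qpow_inf q (q ^ (- (n + 1)) * (q / al))).
Proof.
move=> q0 q1 al0; have qn0 : q != 0 by rewrite gt_eqF.
rewrite (qpow_infS (q ^ n * al)) // (qpow_infS (q ^ (- (n + 1)) * _)) //.
have -> : q * (q ^ n * al) = q ^ (n + 1) * al.
  by rewrite expfzDr // expr1z; ring.
have xx : q ^ (- n) * q ^ n = 1 by rewrite -expfzDr // addNr expr0z.
have -> : q ^ (- (n + 1)) * (q / al) = q ^ (- n) / al.
  by rewrite opprD expfzDr // exprN1; field; rewrite qn0 gt_eqF.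
have -> : q * (q ^ (- n) / al) = q ^ (- n) * (q / al) by ring.
have -> : q ^ n * al * (qpow_inf q (q ^ (n + 1) * al) *
    ((1 + q ^ (- n) / al) * qpow_inf q (q ^ (- n) * (q / al)))) =
   (q ^ n * al + (q ^ (- n) * q ^ n) * (al / al)) * (qpow_inf q (q ^ (n + 1) * al) *
     qpow_inf q (q ^ (- n) * (q / al))) by ring.
rewrite xx divff ?gt_eqF //; ring.
Qed.

(** Both terms contain P(q^(n+1) be). The multiplier is the product of q^n al, from the
    denominators, and 1 + q^-(n+1) ga, the factor split off from the product in [ga]. *)
Lemma psi_termS (R : realType) (q al be ga : R) (n : int) :
  0 < q -> q < 1 -> 0 < al ->
  psi_term q al be ga (n + 1) =
  al * (q ^ n + ga / q) * psi_term q al (q * be) ga n.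
Proof.
move=> q0 q1 al0; have qn0 : q != 0 by rewrite gt_eqF.
have aln0 : al != 0 by rewrite gt_eqF.
have qa0 : 0 < q / al by rewrite divr_gt0.
have xx : q ^ n * q ^ (- n) = 1 by rewrite -expfzDr // subrr expr0z.
have x0 : q ^ n != 0 by rewrite expfz_neq0.
rewrite /psi_term (psi_term_den_shift n) // (qpow_infS (q ^ (- (n + 1)) * ga)) //.
have -> : q * (q ^ (- (n + 1)) * ga) = q ^ (- n) * ga.
  by rewrite opprD expfzDr // exprN1; field.
have -> : q ^ n * (q * be) = q ^ (n + 1) * be.
  by rewrite expfzDr // expr1z; ring.
have -> : q ^ (- (n + 1)) * ga = (q ^ n)^-1 * ga / q.
  by rewrite opprD expfzDr // exprN1 invr_expz; ring.
have d1 := psi_den_neq0 (n + 1) q0 q1 al0.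
have d2 := psi_den_neq0 (- (n + 1)) q0 q1 qa0.
by field; rewrite d1 d2 x0 aln0 qn0.
Qed.

Lemma psi_term_factor (R : realType) (q al be ga : R) (n : int) :
  0 < q -> q < 1 ->
  psi_term q al be ga n = (1 + q ^ n * be) * psi_term q al (q * be) ga n.
Proof.
move=> q0 q1; rewrite /psi_term (qpow_infS (q ^ n * be)) // [q * (_ * be)]mulrCA.
by rewrite !mulrA.
Qed.

(** Both terms on the left are multiples of the term on the right, by 1 + q^n be and by be q^n + be
    ga/q. In the difference q^n cancels, so the remaining coefficient is free of [n] and the
    relation can be summed. *)
Lemma psi_term_contiguous (R : realType) (q al be ga : R) (n : int) :
  0 < q -> q < 1 -> 0 < al ->
  psi_term q al be ga n - be / al * psi_term q al be ga (n + 1) =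
  (1 - be * ga / q) * psi_term q al (q * be) ga n.
Proof.
move=> q0 q1 al0; rewrite psi_termS // psi_term_factor //.
by field; rewrite !gt_eqF.
Qed.

Lemma psi_const_step (R : realType) (q al be ga : R) :
  0 < q -> q < 1 -> 0 < al -> be < al ->
  (1 - be / al) * psi_const q al be ga =
  (1 - be * ga / q) * psi_const q al (q * be) ga.
Proof.
move=> q0 q1 al0 bal.
have nz : 1 - be / al != 0 by rewrite subr_eq0 gt_eqF // ltr_pdivrMr ?mul1r.
rewrite /psi_const (qpow_infS (- (be * ga / q))) // (qpow_infS (- (be / al))) //.
have -> : q * - (be * ga / q) = - (q * be * ga / q) by ring.
have -> : q * - (be / al) = - (q * be / al) by ring.
rewrite -[(1 - be / al) * _ * _]mulrA invfM.
by rewrite [LHS]mulrCA [_ * (_^-1 * _)]mulrA divff // mul1r mulrA.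
Qed.

(** The series and its shift have the same sum, so summing the contiguity relation gives the
    functional equation. Writing the sum as [psi_const] times [s] makes [s] an invariant of the
    step. *)
Lemma psi_sum_step (R : realType) (q al be ga s : R) :
  0 < q -> q < 1 -> 0 < al -> be < al -> be * ga < q ->
  is_bilateral_sum (psi_term q al be ga) (psi_const q al be ga * s) ->
  is_bilateral_sum (psi_term q al (q * be) ga) (psi_const q al (q * be) ga * s).
Proof.
move=> q0 q1 al0 bal bgq h.
have nz : 1 - be * ga / q != 0 by rewrite subr_eq0 gt_eqF // ltr_pdivrMr ?mul1r.
have h1 := bilateral_sumB h (bilateral_sumZ (be / al) (bilateral_sum_shift h)).
have h2 := bilateral_sumZ (1 - be * ga / q)^-1 h1.
have -> : psi_const q al (q * be) ga * s =
    (1 - be * ga / q)^-1 * (psi_const q al be ga * s -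
      be / al * (psi_const q al be ga * s)).
  have -> : psi_const q al be ga * s - be / al * (psi_const q al be ga * s) =
      (1 - be / al) * psi_const q al be ga * s by ring.
  by rewrite psi_const_step // [RHS]mulrA mulKf.
apply: eq_bilateral_sum h2 => n.
by rewrite psi_term_contiguous // mulKf.
Qed.

(** This is [psi_sum_step] conjugated by the reflection of the index. *)
Lemma psi_sum_stepC (R : realType) (q al be ga s : R) :
  0 < q -> q < 1 -> 0 < al -> ga < q / al -> be * ga < q ->
  is_bilateral_sum (psi_term q al be ga) (psi_const q al be ga * s) ->
  is_bilateral_sum (psi_term q al be (q * ga)) (psi_const q al be (q * ga) * s).
Proof.
move=> q0 q1 al0 gqa bgq h.
have qa0 : 0 < q / al by rewrite divr_gt0.
have qqa : q / (q / al) = al by field; rewrite !gt_eqF.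
have e c n : psi_term q (q / al) c be (- n) = psi_term q al be c n.
  by rewrite psi_termN // qqa.
rewrite psi_constC //.
have := bilateral_sumN h; rewrite psi_constC // => h1.
have h2 : is_bilateral_sum (psi_term q (q / al) ga be)
    (psi_const q (q / al) ga be * s).
  by apply: eq_bilateral_sum h1 => n; rewrite psi_termN.
have gbq : ga * be < q by rewrite mulrC.
have h3 := bilateral_sumN (psi_sum_step q0 q1 qa0 gqa gbq h2).
exact: eq_bilateral_sum (e (q * ga)) h3.
Qed.

(** * Iteration and passage to the limit *)

(** It keeps the bounds on [be], [ga] and [be * ga] true along the iteration, whatever the signs. *)
Lemma lt_scale (R : realType) (q x y : R) :
  0 < q -> q < 1 -> 0 < y -> x < y -> q * x < y.
Proof. by move=> q0 q1 y0 xy; have [x0|x0] := leP 0 x; nra. Qed.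

Lemma psi_sum_iter (R : realType) (q al be ga s : R) (N : nat) :
  0 < q -> q < 1 -> 0 < al -> be < al -> ga < q / al -> be * ga < q ->
  is_bilateral_sum (psi_term q al be ga) (psi_const q al be ga * s) ->
  is_bilateral_sum (psi_term q al (q ^+ N * be) (q ^+ N * ga))
    (psi_const q al (q ^+ N * be) (q ^+ N * ga) * s).
Proof.
move=> q0 q1 al0; elim: N be ga => [|N IH] be ga bal gqa bgq h.
  by rewrite expr0 !mul1r.
have qa0 : 0 < q / al by rewrite divr_gt0.
have bgq' : q * be * ga < q by rewrite -mulrA lt_scale.
(* One factor [q] is moved onto each parameter, so that the induction hypothesis applies to [q * be]
   and [q * ga]. *)
rewrite exprSr -(mulrA _ q be) -(mulrA _ q ga); apply: IH; try exact: lt_scale.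
  by rewrite mulrCA lt_scale.
by apply: psi_sum_stepC => //; apply: psi_sum_step.
Qed.

Lemma cvg_psi_const (R : realType) (q al be ga : R) : 0 < q -> q < 1 ->
  (fun N => psi_const q al (q ^+ N * be) (q ^+ N * ga)) @ \oo --> (1 : R).
Proof.
move=> q0 q1; pose P v := fun N => qpow_inf q (q ^+ N * v).
(* The product [be * ga] is scaled by q^(2N), whence the index [N + N]. *)
have dbl : (fun N => P (- (be * ga / q)) (N + N)%N) @ \oo --> (1 : R).
  have add : (fun n : nat => (n + n)%N) @ \oo --> \oo.
    by move=> A [N _ HA]; exists N => // n /= Nn; apply: HA; exact: leq_trans (leq_addr _ _).
  exact: (cvg_comp _ _ add (cvg_qpow_inf1 _ q0 q1)).
have den : (fun N => (P (- (be / al)) N * P (- (al * ga / q)) N)^-1)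
    @ \oo --> (1 : R).
  rewrite -[X in _ --> X]invr1; apply: cvgV; first exact: oner_neq0.
  rewrite -[X in _ --> X]mulr1.
  by apply: cvgM; exact: cvg_qpow_inf1.
rewrite -[X in _ --> X]mulr1; apply: eq_cvgn (cvgM dbl den) => N.
rewrite /psi_const /P /= exprD.
congr (qpow_inf q _ / (qpow_inf q _ * qpow_inf q _)); ring.
Qed.

(** The dominating [D] is a parameter because two choices occur: the terms at (0, 0) when both
    parameters are [- q], and the initial terms themselves when both are nonnegative. *)
Lemma psi_sum_limit (R : realType) (q al be ga s d : R) (D : int -> R) :
  0 < q -> q < 1 -> 0 < al -> be < al -> ga < q / al -> be * ga < q ->
  is_bilateral_sum D d ->
  (forall N n, `|psi_term q al (q ^+ N * be) (q ^+ N * ga) n| <= D n) ->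
  is_bilateral_sum (psi_term q al be ga) (psi_const q al be ga * s) ->
  is_bilateral_sum (psi_term q al 0 0) s.
Proof.
move=> q0 q1 al0 bal gqa bgq hD dom h.
apply: (bilateral_sum_dominated dom hD) (fun N => psi_sum_iter N q0 q1 al0 bal gqa bgq h) _.
- move=> n; rewrite /psi_term !mulr0 qpow_inf0 mulr1.
  apply: cvgM; last exact: cvg_cst.
  rewrite -[X in _ --> X]mulr1; apply: cvgM.
    by apply: eq_cvgn (cvg_qpow_inf1 (q ^ n * be) q0 q1) => N; rewrite mulrCA.
  by apply: eq_cvgn (cvg_qpow_inf1 (q ^ (- n) * ga) q0 q1) => N; rewrite mulrCA.
- rewrite -[X in _ --> X]mul1r; apply: cvgM; last exact: cvg_cst.
  exact: cvg_psi_const.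
Qed.

(** * Convergence for nonnegative parameters *)

Lemma psi_term_ge0 (R : realType) (q al be ga : R) (n : int) :
  0 < q -> q < 1 -> 0 < al -> 0 <= be -> 0 <= ga -> 0 <= psi_term q al be ga n.
Proof.
move=> q0 q1 al0 be0 ga0; rewrite /psi_term.
have p x m : 0 <= x -> 0 <= qpow_inf q (q ^ m * x).
  by move=> x0; apply/ltW/qpow_inf_gt0 => //; rewrite mulr_ge0 ?exprz_ge0 // ltW.
by rewrite divr_ge0 ?mulr_ge0 ?p ?divr_ge0 // ltW.
Qed.

(** By [psi_termS] and [psi_term_factor] the ratio of consecutive terms is al (q^n + ga/q) / (1 +
    q^n be). Its limit al ga/q is below 1 exactly when [ga < q / al]. *)
Lemma psi_term_is_cvg (R : realType) (q al be ga : R) :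
  0 < q -> q < 1 -> 0 < al -> 0 <= be -> 0 <= ga -> ga < q / al ->
  cvgn (series (fun n : nat => psi_term q al be ga n%:Z)).
Proof.
move=> q0 q1 al0 be0 ga0 gqa.
have qn n : 0 <= q ^+ n :> R by rewrite exprn_ge0 // ltW.
apply: (cvg_series_ratio (r := al * (ga / q))
  (rho := fun n => al * (q ^+ n + ga / q) / (1 + q ^+ n * be))).
- by move=> n; exact: psi_term_ge0.
- move=> n; rewrite -addn1 PoszD psi_termS // [X in _ = _ * X]psi_term_factor //.
  by rewrite -exprnP [RHS]mulrA divfK // gt_eqF // ltr_pwDl // mulr_ge0.
- have cq : (fun n => q ^+ n) @ \oo --> (0 : R).
    by apply: cvg_expr; rewrite ger0_norm // ltW.
  have -> : al * (ga / q) = al * (0 + ga / q) * (1 + 0 * be)^-1.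
    by rewrite add0r mul0r addr0 invr1 mulr1.
  apply: cvgM.
    by apply: cvgM; [exact: cvg_cst|apply: cvgD => //; exact: cvg_cst].
  apply: cvgV; first by rewrite mul0r addr0 oner_neq0.
  by apply: cvgD; [exact: cvg_cst|apply: cvgM => //; exact: cvg_cst].
- by rewrite mulr_ge0 // ?divr_ge0 // ltW.
- by rewrite mulrA ltr_pdivrMr // mul1r mulrC -ltr_pdivlMr.
Qed.

(** The negative half is the nonnegative half of the reflected series without its term at 0; there
    the ratio test requires [be < al]. *)
Lemma psi_sum_exists (R : realType) (q al be ga : R) :
  0 < q -> q < 1 -> 0 < al -> 0 <= be -> be < al -> 0 <= ga -> ga < q / al ->
  exists l, is_bilateral_sum (psi_term q al be ga) l.
Proof.
move=> q0 q1 al0 be0 bal ga0 gqa.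
have qa0 : 0 < q / al by rewrite divr_gt0.
have qqa : q / (q / al) = al by field; rewrite !gt_eqF.
have /cvg_ex[p hp] := psi_term_is_cvg q0 q1 al0 be0 ga0 gqa.
have /cvg_ex[m hm] : cvgn (series (fun n : nat => psi_term q (q / al) ga be n%:Z)).
  by apply: psi_term_is_cvg; rewrite ?qqa.
exists (p + (m - psi_term q (q / al) ga be 0)), p,
  (m - psi_term q (q / al) ga be 0); split => //.
apply: eq_cvgn (cvg_series_shift hm) => n.
by congr (series _ n); apply/funext => k; rewrite psi_termN.
Qed.

(** * The value of S(0, 0) *)

(** The factor of index [k], the last of the first [k.+1], is 1 - q^k q^-k. *)
Lemma qpow_infNX_eq0 (R : realType) (q : R) (k : nat) : 0 < q -> q < 1 ->
  qpow_inf q (- q ^ (- k%:Z)) = 0.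
Proof.
move=> q0 q1; rewrite (qpow_infD _ k.+1 q0 q1) qpow_finSr -exprnN.
by rewrite mulrN divff ?expf_neq0 ?gt_eqF // subrr mulr0 mul0r.
Qed.

(** The product vanishes for negative [k] and lies in the unit interval otherwise. This bounds the
    numerators when both parameters are [- q] times a power of [q]. *)
Lemma normr_qpow_infNX_le1 (R : realType) (q : R) (k : int) : 0 < q -> q < 1 ->
  `|qpow_inf q (- q ^ k)| <= 1.
Proof.
move=> q0 q1; case: k => k; last first.
  by rewrite NegzE qpow_infNX_eq0 // normr0 ler01.
have qk0 : 0 <= q ^+ k by rewrite exprn_ge0 // ltW.
have qk1 : q ^+ k <= 1 by rewrite exprn_ile1 // ltW.
have n1 : -1 <= - q ^+ k by rewrite lerN2.
have n0 : - q ^+ k <= 0 by rewrite oppr_le0.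
have /andP[h1 h2] := qpow_inf_itv q0 q1 n1 n0.
by rewrite -exprnP ger0_norm.
Qed.

(* This is the Jacobi triple product, in disguise. *)
Lemma psi_sum0 (R : realType) (q al : R) : 0 < q -> q < 1 -> 0 < al ->
  is_bilateral_sum (psi_term q al 0 0) (qpow_inf q (- q)).
Proof.
move=> q0 q1 al0.
have qa0 : 0 < q / al by rewrite divr_gt0.
have qn0 : q != 0 by rewrite gt_eqF.
(* Only convergence matters here: this series will serve as the dominating one. *)
have [d hd] : exists d, is_bilateral_sum (psi_term q al 0 0) d.
  exact: psi_sum_exists.
have eqX N (n : int) : q ^ n * (q ^+ N * - q) = - q ^ (n + N.+1%:Z).
  by rewrite expfzDr // -exprnP exprSr; ring.
apply: (psi_sum_limit (be := - q) (ga := - q) q0 q1 al0 _ _ _ hd).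
- by apply: lt_trans al0; rewrite oppr_lt0.
- by apply: lt_trans qa0; rewrite oppr_lt0.
- by rewrite mulrNN -[ltRHS]mulr1 ltr_pM2l.
(* Both numerator factors have the form P(-q^k), of modulus at most 1, while the numerator at (0, 0)
   is 1. *)
- move=> N n; rewrite /psi_term !mulr0 qpow_inf0 mulr1 !eqX.
  rewrite normrM normfV [X in _ / X <= _]ger0_norm; last first.
    by rewrite ltW // mulr_gt0 // qpow_inf_gt0 // mulr_ge0 ?exprz_ge0 // ltW.
  rewrite ler_pM2r ?invr_gt0; last first.
    by rewrite mulr_gt0 // qpow_inf_gt0 // mulr_ge0 ?exprz_ge0 // ltW.
  by rewrite normrM mulr_ile1 ?normr_ge0 ?normr_qpow_infNX_le1.
- have eqX0 (n : int) : q ^ n * - q = - q ^ (n + 1).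
    by rewrite expfzDr // expr1z mulrN.
  (* The constant is P(-q) / (P(q/al) P(al)) and the term at 0 is P(-q)^2 / (P(al) P(q/al)), which
     forces [s] to be P(-q). *)
  have -> : psi_const q al (- q) (- q) * qpow_inf q (- q) =
      psi_term q al (- q) (- q) 0.
    rewrite /psi_const /psi_term oppr0 !expr0z !mul1r.
    have -> : - (- q * - q / q) = - q by field.
    have -> : - (- q / al) = q / al by rewrite mulNr opprK.
    have -> : - (al * - q / q) = al by field.
    by rewrite mulrAC [X in _ / X]mulrC.
  apply: bilateral_sum_single => n n0; rewrite /psi_term !eqX0.
  (* For [n] nonzero, one of [n + 1] and [- n + 1] is at most 0, so a numerator factor vanishes. *)
  have [m [->|->]] : exists m : nat, n + 1 = - m%:Z \/ - n + 1 = - m%:Z.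
    case: n n0 => [[|k]|k] // _; [exists k; right|exists k; left]; lia.
  - by rewrite qpow_infNX_eq0 // !mul0r.
  - by rewrite qpow_infNX_eq0 // mulr0 mul0r.
Qed.

(** * The general sum and the theorem *)

(** The sum [l] exists by the ratio test. The limit argument with [s := l / psi_const] shows that
    this quotient is S(0, 0), and uniqueness identifies it with the value in [psi_sum0]. *)
Lemma psi_sum (R : realType) (q al be ga : R) :
  0 < q -> q < 1 -> 0 < al -> 0 <= be -> be < al -> 0 <= ga -> ga < q / al ->
  is_bilateral_sum (psi_term q al be ga)
    (psi_const q al be ga * qpow_inf q (- q)).
Proof.
move=> q0 q1 al0 be0 bal ga0 gqa.
have qa0 : 0 < q / al by rewrite divr_gt0.
have [l hl] := psi_sum_exists q0 q1 al0 be0 bal ga0 gqa.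
have agq : ga * al < q by rewrite -ltr_pdivlMr.
have bgq : be * ga < q.
  by apply: le_lt_trans agq; rewrite mulrC ler_wpM2l // ltW.
have Kn0 : psi_const q al be ga != 0.
  rewrite /psi_const mulf_neq0 ?invr_eq0 ?mulf_neq0 ?qpow_inf_neq0 //.
  - by rewrite ltrN2 ltr_pdivrMr ?mul1r.
  - by rewrite ltrN2 ltr_pdivrMr ?mul1r.
  - by rewrite ltrN2 ltr_pdivrMr ?mul1r // mulrC.
have qN N : 0 <= q ^+ N <= 1 by rewrite exprn_ge0 ?exprn_ile1 // ltW.
have h : is_bilateral_sum (psi_term q al 0 0) (l / psi_const q al be ga).
  apply: (psi_sum_limit q0 q1 al0 bal gqa bgq hl); last first.
    by rewrite mulrC divfK.
  (* P is increasing on nonnegative arguments, so shrinking [be] and [ga] only decreases the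
     terms. *)
  move=> N n; have /andP[qN0 qN1] := qN N.
  rewrite ger0_norm; last by apply: psi_term_ge0 => //; exact: mulr_ge0.
  rewrite /psi_term ler_pM2r ?invr_gt0; last first.
    by rewrite mulr_gt0 // qpow_inf_gt0 // mulr_ge0 ?exprz_ge0 // ltW.
  have le_shrink x (k : int) : 0 <= x ->
      0 <= qpow_inf q (q ^ k * (q ^+ N * x)) <= qpow_inf q (q ^ k * x).
    move=> x0; have qk0 : 0 <= q ^ k by rewrite exprz_ge0 // ltW.
    rewrite ltW ?qpow_inf_gt0 ?mulr_ge0 //=.
    by rewrite le_qpow_inf ?mulr_ge0 // ler_wpM2l // ler_piMl.
  have /andP[b1 b2] := le_shrink be n be0.
  have /andP[g1 g2] := le_shrink ga (- n) ga0.
  exact: ler_pM.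
by rewrite -(bilateral_sum_unique h (psi_sum0 q0 q1 al0)) mulrC divfK.
Qed.

Theorem mainTheorem5 (R : realType) (q a b c : R)
  (hq0 : 0 < q) (hq1 : q < 1)
  (ha : a < 0) (hab : a < b) (hb : b < 0)
  (hac : q / a < c) (hc : c < 0) :
  is_bilateral_sum
    (fun n : int =>
       (qpow q (- a) n * qpow q (- (q / a)) (- n)) /
       (qpow q (- b) n * qpow q (- c) (- n)))
    ((qpow_inf q (- a) * qpow_inf q (- (q / a))) /
       (qpow_inf q (- b) * qpow_inf q (- c)) *
     ((qpow_inf q (- q) * qpow_inf q (- (b * c / q))) /
       (qpow_inf q (- (b / a)) * qpow_inf q (- (a * c / q))))).
Proof.
have eqa : - (q / a) = q / - a by rewrite invrN mulrN.
have al0 : 0 < - a by rewrite oppr_gt0.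
have be0 : 0 < - b by rewrite oppr_gt0.
have ga0 : 0 < - c by rewrite oppr_gt0.
have qa0 : 0 < q / - a by rewrite divr_gt0.
have h : is_bilateral_sum (psi_term q (- a) (- b) (- c))
    (psi_const q (- a) (- b) (- c) * qpow_inf q (- q)).
  by apply: psi_sum => //; rewrite ?ltW // ?ltrN2 // -eqa ltrN2.
pose C := qpow_inf q (- a) * qpow_inf q (- (q / a)) /
  (qpow_inf q (- b) * qpow_inf q (- c)).
rewrite -/C.
have -> : C * ((qpow_inf q (- q) * qpow_inf q (- (b * c / q))) /
       (qpow_inf q (- (b / a)) * qpow_inf q (- (a * c / q)))) =
  C * (psi_const q (- a) (- b) (- c) * qpow_inf q (- q)).
  rewrite /psi_const !mulrNN invrN mulrNN.
  by congr (C * _); rewrite [RHS]mulrC mulrA.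
apply: eq_bilateral_sum (bilateral_sumZ C h) => n.
have nz x m : 0 < x -> qpow_inf q (q ^ m * x) != 0 by exact: psi_den_neq0.
have nz0 x : 0 < x -> qpow_inf q x != 0.
  by move=> x0; rewrite gt_eqF // qpow_inf_gt0 // ltW.
(* The side conditions are that P is nonzero at the positive arguments that occur in
   denominators. *)
rewrite /C /psi_term /qpow eqa; field.
by rewrite !nz // !nz0.
Qed.
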